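(* Let $G,s\in\mathbb N$ with $s\ge 2$, let $\varepsilon\in(0,\tfrac12)$ and let the true parameter satisfy $\theta_0\in[\varepsilon,1-\varepsilon]$. Let $(X_i,T_i)'$, $i=1,\dots,n$, $n\in\mathbb N$, be i.i.d. random vectors such that, for each $i$, $X_i$ is geometric with $\tilde P_{\theta_0}(X_i=x)=\theta_0(1-\theta_0)^{x-1}$, $x\in\mathbb N$, $T_i$ takes values in $\{0,1,\dots,G-1\}$, and $X_i$ is independent of $T_i$. With $${}^{PB}Y_{nx}:=\frac{1}{\sqrt n}\,\frac{1}{\theta_0(1-\theta_0)}\,\Delta\,{}_TM^c_\cdot(x),\qquad x=1,\dots,s+G-1,$$ and $${}^{PB}\sigma^2:=\frac{1}{\theta_0(1-\theta_0)}\sum_{x=1}^{s+G-1}\mathrm E_{\theta_0}\{{}_TY_1^c(x-1)\},$$ it holds that $$\sum_{x=1}^{s+G-1}{}^{PB}Y_{nx}\ \Rightarrow\ {}^{PB}\sigma\, Z\qquad (n\to\infty),$$ where $Z\sim N(0,1)$ and $\Rightarrow$ denotes convergence in distribution.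
   Context: $\mathbb N=\{1,2,\dots\}$, $a\wedge b=\min(a,b)$, and $\Delta Z(x):=Z(x)-Z(x-1)$ for a process $Z$ indexed by $\mathbb N_0$. The vector $(X_i,T_i)$ is observed only if $X_i\ge T_i+1$ (left truncation), and observation stops after $s$ years (right censoring); the sample size $n$ is that of the latent sample, including unobserved units. $\mathrm E_{\theta_0}$ is expectation under the (unconditional) law $\tilde P_{\theta_0}$. For each unit $i$ and $x\in\mathbb N_0$ define the left-truncated, right-censored counting process ${}_TN_i^c(x):=\mathbf 1_{\{T_i<X_i\le x\wedge(T_i+s)\}}$ and the at-risk process ${}_TY_i^c(x):=\mathbf 1_{\{T_i\le x\}}\mathbf 1_{\{x+1\le T_i+s\}}\mathbf 1_{\{X_i\ge x+1\}}$. Put ${}_TN^c_\cdot(x):=\sum_{i=1}^n{}_TN_i^c(x)$, ${}_TY^c_\cdot(x):=\sum_{i=1}^n{}_TY_i^c(x)$, and $${}_TM^c_\cdot(x):={}_TN^c_\cdot(x)-\theta_0\sum_{k=1}^{x}{}_TY^c_\cdot(k-1),$$ so that $\Delta\,{}_TM^c_\cdot(x)=\Delta\,{}_TN^c_\cdot(x)-\theta_0\,{}_TY^c_\cdot(x-1)$. *)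

(* Defs.v *)
From HB Require Import structures.
From mathcomp Require Import all_boot all_order all_algebra finmap.
From mathcomp Require Import all_classical all_reals all_analysis.
From mathcomp Require Import measurable_realfun.

Set Implicit Arguments.
Unset Strict Implicit.
Unset Printing Implicit Defensive.

Import Order.TTheory GRing.Theory Num.Theory.
Import numFieldNormedType.Exports.

Local Open Scope classical_set_scope.
Local Open Scope ring_scope.

Section random_vectors.
Context d (Om : measurableType d) (R : realType) (P : probability Om R).

Definition pair_RV d1 d2 (U1 : measurableType d1) (U2 : measurableType d2)
    (X : {RV P >-> U1}) (Y : {RV P >-> U2}) : Om -> U1 * U2 :=
  fun w => (X w, Y w).

Lemma measurable_pair_RV d1 d2 (U1 : measurableType d1)
    (U2 : measurableType d2) (X : {RV P >-> U1}) (Y : {RV P >-> U2}) :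
  measurable_fun [set: Om] (pair_RV X Y).
Proof. by apply: measurable_fun_pair; exact: measurable_funPT. Qed.

HB.instance Definition _ d1 d2 (U1 : measurableType d1)
    (U2 : measurableType d2) (X : {RV P >-> U1}) (Y : {RV P >-> U2}) :=
  isMeasurableFun.Build _ _ Om (U1 * U2)%type (pair_RV X Y)
    (measurable_pair_RV X Y).

Local Open Scope ereal_scope.

Definition independent_RVs d1 d2 (U1 : measurableType d1)
    (U2 : measurableType d2) (X : {RV P >-> U1}) (Y : {RV P >-> U2}) : Prop :=
  forall A B, measurable A -> measurable B ->
    P (X @^-1` A `&` Y @^-1` B) = P (X @^-1` A) * P (Y @^-1` B).

Definition mutually_independent_RVs (I : choiceType) d' (U : measurableType d')
    (V : I -> {RV P >-> U}) : Prop :=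
  forall (J : {fset I}) (A : I -> set U), (forall i, measurable (A i)) ->
    P (\bigcap_(i in [set` J]) (V i @^-1` A i)) =
    \prod_(i <- J) P (V i @^-1` A i).

Definition identically_distributed (I : Type) d' (U : measurableType d')
    (V : I -> {RV P >-> U}) : Prop :=
  forall i j A, measurable A ->
    distribution P (V i) A = distribution P (V j) A.

Definition iid_RVs (I : choiceType) d' (U : measurableType d')
    (V : I -> {RV P >-> U}) : Prop :=
  mutually_independent_RVs V /\ identically_distributed V.

Local Close Scope ereal_scope.

Definition geometric_RV (theta : R) (X : {RV P >-> nat}) : Prop :=
  forall x : nat, (1 <= x)%N ->
    P [set w | X w = x] = (theta * (1 - theta) ^+ x.-1)%:E.

End random_vectors.

(* Convergence of the distribution functions at every continuity point of the
   limit; the limit may live on another probability space. *)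
Definition cvg_in_distribution d d' (Om : measurableType d)
    (Om' : measurableType d') (R : realType)
    (P : probability Om R) (P' : probability Om' R)
    (S : nat -> {RV P >-> R}) (L : {RV P' >-> R}) : Prop :=
  forall r : R, {for r, continuous (cdf L)} ->
    cdf (S n) r @[n --> \oo] --> cdf L r.

(* Only meaningful for 1 <= x. *)
Definition increment (V : zmodType) (Z : nat -> V) (x : nat) : V :=
  Z x - Z x.-1.

Section truncated_censored.
Context d (Om : measurableType d) (R : realType) (P : probability Om R).
Variables (G s : nat) (theta0 : R).

Definition count_process (X T : {RV P >-> nat}) (x : nat) (w : Om) : R :=
  (T w < X w <= minn x (T w + s))%N%:R.

Definition at_risk (X T : {RV P >-> nat}) (x : nat) (w : Om) : R :=
  [&& T w <= x, x.+1 <= T w + s & x.+1 <= X w]%N%:R.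

Lemma measurable_bool_natr (b : Om -> bool) :
  measurable_fun setT b -> measurable_fun setT (fun w => (b w)%:R : R).
Proof. by move=> mb; apply: (measurableT_comp (f := fun c : bool => c%:R : R)). Qed.

Lemma measurable_count_process (X T : {RV P >-> nat}) x :
  measurable_fun setT (count_process X T x).
Proof.
apply: measurable_bool_natr; apply: measurable_and.
  by apply: measurable_fun_ltn; exact: measurable_funPT.
apply: measurable_fun_leq; first exact: measurable_funPT.
by apply: (measurableT_comp (f := fun t => minn x (t + s)%N)).
Qed.

Lemma measurable_at_risk (X T : {RV P >-> nat}) x :
  measurable_fun setT (at_risk X T x).
Proof.
apply: measurable_bool_natr; apply: measurable_and.
  by apply: (measurableT_comp (f := fun t => (t <= x)%N)).
apply: measurable_and.
  by apply: (measurableT_comp (f := fun t => (x < t + s)%N)).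
by apply: (measurableT_comp (f := fun t => (x < t)%N)).
Qed.

Variables X T : nat -> {RV P >-> nat}.

(* Units are numbered from 0: the sample of size n is the units i < n. *)
Definition total_count (n x : nat) (w : Om) : R :=
  \sum_(i < n) count_process (X i) (T i) x w.

Definition total_at_risk (n x : nat) (w : Om) : R :=
  \sum_(i < n) at_risk (X i) (T i) x w.

Definition total_M (n x : nat) (w : Om) : R :=
  total_count n x w - theta0 * \sum_(1 <= k < x.+1) total_at_risk n k.-1 w.

Definition PB_Y (n x : nat) (w : Om) : R :=
  (Num.sqrt n%:R)^-1 * (theta0 * (1 - theta0))^-1 *
  increment (fun y => total_M n y w) x.

Definition PB_sum (n : nat) (w : Om) : R :=
  \sum_(1 <= x < s + G) PB_Y n x w.

Definition PB_sigma2 : R :=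
  (theta0 * (1 - theta0))^-1 *
  \sum_(1 <= x < s + G) fine 'E_P[at_risk (X 0%N) (T 0%N) x.-1].

Definition PB_sigma : R := Num.sqrt PB_sigma2.

Lemma measurable_total_M n x : measurable_fun setT (total_M n x).
Proof.
apply: measurable_funB.
  by apply: measurable_sum => i; exact: measurable_count_process.
apply: measurable_funM => //; apply: measurable_sum => k.
by apply: measurable_sum => i; exact: measurable_at_risk.
Qed.

Lemma measurable_PB_sum n : measurable_fun setT (PB_sum n).
Proof.
apply: measurable_sum => x; apply: measurable_funM => //.
by apply: measurable_funB; exact: measurable_total_M.
Qed.

HB.instance Definition _ n :=
  isMeasurableFun.Build _ _ Om R (PB_sum n) (measurable_PB_sum n).

End truncated_censored.

(* Main.v *)
(** Stein's method.  Exchanging the sums over x and over the units turns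
    the statistic into S = n^(-1/2) times a sum of n i.i.d. copies of a centred
    variable with finitely many values; its variance is the stated sigma^2
    because the increments in x of the compensated counting process are
    orthogonal.  Rescale so that sigma = 1.
    If the summands take the value v_k with probability p_k, then
    E (g S) = (U^n g) 0 for (U g)(x) = sum_k p_k g (x + u_k), u_k = v_k / sqrt n.
    Put (A f)(x) = sum_k p_k u_k f (x + u_k).  As A and U commute,
    U^n (id . f) = id . U^n f + n U^(n-1) (A f), so that
    E [f' S - S f S] = (U^(n-1) (U f' - n A f)) 0, which a second order Taylor
    bound makes O(n^(-1/2)).  Applied to the solution of
    f' w - w f w = h w - E (h Z) for ramp functions h, this gives convergence
    of E (h S), hence of the distribution functions. *)

Require Import Defs.
From HB Require Import structures.
From mathcomp Require Import all_boot all_order all_algebra finmap.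
From mathcomp Require Import all_classical all_reals all_analysis.
From mathcomp Require Import measurable_realfun ring lra zify.

Set Implicit Arguments.
Unset Strict Implicit.
Unset Printing Implicit Defensive.

Import Order.TTheory GRing.Theory Num.Theory.
Import numFieldNormedType.Exports.

Local Open Scope classical_set_scope.
Local Open Scope ring_scope.

(** * The Gaussian distribution and the Stein equation *)

(** The increment [u] may have either sign, so the intermediate point is located only by its
    distance to [x]; the Taylor bounds below use nothing more. *)
Lemma mean_value_real (R : realType) (f df : R -> R) (x u : R) :
  (forall w : R, is_derive w 1 f (df w)) ->
  exists2 c, `|c - x| <= `|u| & f (x + u) - f x = df c * u.
Proof.
move=> fdf; have cf (a b : R) : {within `[a, b], continuous f}.
  by apply: derivable_within_continuous => w _; have [] := fdf w.
have [u0|u0] := leP 0 u.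
  have xu : x <= x + u by rewrite lerDl.
  have [c cxu e] := MVT_segment xu (fun w _ => fdf w) (cf _ _).
  exists c; last by rewrite e addrAC subrr add0r.
  by move: cxu; rewrite in_itv/= => cxu; rewrite ler_norml (ger0_norm u0); lra.
have xu : x + u <= x by rewrite gerDl ltW.
have [c cxu e] := MVT_segment xu (fun w _ => fdf w) (cf _ _).
exists c; last by rewrite -opprB e; ring.
by move: cxu; rewrite in_itv/= => cxu; rewrite ler_norml (ltr0_norm u0); lra.
Qed.

Section gaussian.
Context {R : realType}.
Local Notation mu := (@lebesgue_measure R).
Implicit Types (g h f : R -> R) (x y w : R).

Definition gauss_pdf : R -> R := normal_pdf 0 1.

Lemma gauss_pdfE x : gauss_pdf x = normal_peak 1 * expR (- (x ^+ 2 / 2)).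
Proof.
by rewrite /gauss_pdf normal_pdfE ?oner_neq0// /normal_fun subr0 expr1n mulNr.
Qed.

Lemma gauss_pdf_gt0 x : 0 < gauss_pdf x.
Proof. by rewrite gauss_pdfE mulr_gt0 ?expR_gt0// normal_peak_gt0// oner_neq0. Qed.

Lemma is_derive_gauss_pdf x : is_derive x 1 gauss_pdf (- x * gauss_pdf x).
Proof.
have -> : gauss_pdf = normal_peak 1 *: (expR \o (fun y => - (y ^+ 2 / 2))).
  by apply/funext => y; rewrite gauss_pdfE.
have h : is_derive x 1 (fun y : R => - (y ^+ 2 / 2)) (- x).
  have -> : (fun y : R => - (y ^+ 2 / 2)) = (- 2^-1) *: (@GRing.exp R ^~ 2%N).
    by apply/funext => y /=; change (- (y ^+ 2 / 2) = - 2^-1 * y ^+ 2); ring.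
  apply: is_derive_eq; rewrite /GRing.scale /=.
    by change (- 2^-1 * (x * 1 + x * 1) = - x); field.
apply: is_derive_eq; set e := expR (- (x ^+ 2 / 2)).
change (normal_peak 1 * (e * - x) = - x * (normal_peak 1 * e)); ring.
Qed.

Lemma le_gauss_pdf x : `|x| <= 1 -> gauss_pdf 1 <= gauss_pdf x.
Proof.
move=> x1; rewrite !gauss_pdfE ler_pM2l ?normal_peak_gt0 ?oner_neq0//.
rewrite ler_expR lerN2 ler_pM2r ?invr_gt0//.
by rewrite -(real_normK (num_real x)) lerXn2r ?nnegrE.
Qed.

Lemma integrable_gauss_pdf : mu.-integrable setT (EFin \o gauss_pdf).
Proof. exact: integrable_normal_pdf. Qed.

Lemma integrable_mul_gauss_pdf g (C : R) (D : set R) : measurable D ->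
  measurable_fun setT g -> (forall x, `|g x| <= C) ->
  mu.-integrable D (EFin \o (fun x => g x * gauss_pdf x)).
Proof.
move=> mD mg gC; apply: (@integrableS _ _ _ mu setT D) => //.
apply: (@le_integrable _ _ _ mu setT measurableT _ (fun x => (C * gauss_pdf x)%:E)).
- apply/measurable_EFinP; apply: measurable_funM => //.
  exact: measurable_normal_pdf.
- move=> x _ /=; rewrite lee_fin !normrM ler_wpM2r//.
  exact: le_trans (ler_norm _).
- have := integrableZl measurableT C integrable_gauss_pdf.
  by apply: eq_integrable.
Qed.

(** The distribution function is the case [g = 1], so one absolute-value estimate compares every
    such integral with it. *)
Definition gauss_prim g w : R := \int[mu]_(t in `]-oo, w]) (g t * gauss_pdf t).
Definition gauss_mean g : R := \int[mu]_t (g t * gauss_pdf t).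
Definition gauss_cdf : R -> R := gauss_prim (fun=> 1).

Lemma is_derive_gauss_prim g (C : R) w : continuous g ->
  (forall x, `|g x| <= C) -> is_derive w 1 (gauss_prim g) (g w * gauss_pdf w).
Proof.
move=> cg gC; have mg := continuous_measurable_fun cg.
have [||||dG e] := @continuous_FTC1 R (fun t => g t * gauss_pdf t) -oo%O w (w + 1).
- by rewrite ltrDl.
- exact: (integrable_mul_gauss_pdf _ mg gC).
- exact: ltNyr.
- apply: cvgM; first exact: cg.
  by apply: continuous_normal_pdf; exact: oner_neq0.
- by apply: DeriveDef => //; rewrite -derive1E.
Qed.

Lemma norm_int_gauss_le g (D : set R) : measurable D ->
  measurable_fun setT g -> (forall x, `|g x| <= 1) ->
  `|\int[mu]_(t in D) (g t * gauss_pdf t)| <=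
  \int[mu]_(t in D) (1 * gauss_pdf t).
Proof.
move=> mD mg g1; apply: (le_trans (le_normr_Rintegral _ _)) => //.
  exact: (@integrable_mul_gauss_pdf _ 1).
apply: le_Rintegral => //.
- have : mu.-integrable D (EFin \o (fun x => `|g x| * gauss_pdf x)).
    apply: (@integrable_mul_gauss_pdf _ 1) => //; last by move=> x; rewrite normr_id.
    exact: measurableT_comp.
  apply: eq_integrable => // x _ /=.
  by rewrite normrM (gtr0_norm (gauss_pdf_gt0 _)).
- by apply: (@integrable_mul_gauss_pdf _ 1) => // x; rewrite normr1.
- by move=> x _; rewrite normrM (gtr0_norm (gauss_pdf_gt0 _)) ler_wpM2r// ltW// gauss_pdf_gt0.
Qed.

Lemma gauss_prim_cdf_le g w : measurable_fun setT g -> (forall x, `|g x| <= 1) ->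
  `|gauss_prim g w| <= gauss_cdf w.
Proof. exact: norm_int_gauss_le. Qed.

Lemma gauss_mean_split g (C : R) w : measurable_fun setT g ->
  (forall x, `|g x| <= C) ->
  gauss_mean g = gauss_prim g w + \int[mu]_(t in `]w, +oo[) (g t * gauss_pdf t).
Proof.
move=> mg gC; have sT : `]-oo, w] `|` `]w, +oo[ = [set: R].
  rewrite -subTset => x _; rewrite /= !in_itv/= andbT.
  by case: (leP x w) => ?; [left|right].
rewrite /gauss_mean -sT Rintegral_setU//.
  by rewrite sT; exact: (integrable_mul_gauss_pdf _ mg gC).
rewrite disj_set2E; apply/eqP; rewrite -subset0 => x [] /=; rewrite !in_itv/= andbT.
by move=> /le_lt_trans h /h; rewrite ltxx.
Qed.

Lemma gauss_mean1 : gauss_mean (fun=> 1) = 1.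
Proof.
rewrite /gauss_mean /Rintegral; under eq_integral do rewrite mul1r.
by rewrite integral_normal_pdf.
Qed.

Lemma gauss_cdfE w : (gauss_cdf w)%:E = normal_prob 0 1 `]-oo, w].
Proof.
rewrite /gauss_cdf /gauss_prim /Rintegral /normal_prob.
under eq_integral do rewrite mul1r.
rewrite fineK//; apply: integral_fune_fin_num => //.
exact: integrableS integrable_gauss_pdf.
Qed.

(** The identity as a random variable under the normal law: its [cdf] is [gauss_cdf], which gives
    the limits of the latter at both infinities. *)
Let idR : measurableTypeR R -> R := idfun.

#[local] HB.instance Definition _ :=
  @isMeasurableFun.Build _ _ _ _ idR (@measurable_id _ _ setT).

Lemma gauss_cdf_cvgy : gauss_cdf x @[x --> +oo] --> (1 : R).
Proof.
have := @cvg_cdfy1 _ _ _ (normal_prob (0 : R) 1) (idR : {RV normal_prob (0 : R) 1 >-> R}).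
move/fine_cvgP => -[_]; apply: cvg_trans; apply: near_eq_cvg.
by near=> x; rewrite /= /cdf /distribution /pushforward /= -gauss_cdfE.
Unshelve. all: by end_near. Qed.

Lemma gauss_cdf_cvgNy : gauss_cdf x @[x --> -oo] --> (0 : R).
Proof.
have := @cvg_cdfNy0 _ _ _ (normal_prob (0 : R) 1) (idR : {RV normal_prob (0 : R) 1 >-> R}).
move/fine_cvgP => -[_]; apply: cvg_trans; apply: near_eq_cvg.
by near=> x; rewrite /= /cdf /distribution /pushforward /= -gauss_cdfE.
Unshelve. all: by end_near. Qed.

Lemma is_derive_gauss_cdf w : is_derive w 1 gauss_cdf (gauss_pdf w).
Proof.
rewrite -[gauss_pdf w]mul1r; apply: (@is_derive_gauss_prim (fun=> 1) 1) => x.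
  exact: cvg_cst.
by rewrite normr1.
Qed.

(** Mills ratio bound. [D] has derivative [(- x - 1) * gauss_pdf x], nonnegative left of -1, and [D]
    lies above [- gauss_cdf], which tends to 0 at minus infinity; hence [D] is nonnegative there. *)
Lemma gauss_cdf_tailNy w : w <= -1 -> gauss_cdf w <= gauss_pdf w.
Proof.
move=> w1; rewrite -subr_ge0.
pose D := gauss_pdf - gauss_cdf.
have dD x : is_derive x 1 D ((- x - 1) * gauss_pdf x).
  have := is_derive_gauss_pdf x; have := is_derive_gauss_cdf x => ? ?.
  by apply: is_derive_eq; rewrite mulrBl mul1r.
have cD : {within `]-oo, -1], continuous D}.
  by apply: derivable_within_continuous => x _; have [] := dD x.
have ndD x y : x <= y -> y <= -1 -> D x <= D y.
  apply: ger0_derive1_ndecrNy => // z.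
  rewrite in_itv/= => z1; rewrite derive1E (@derive_val _ _ _ _ _ _ _ (dD z)).
  by rewrite mulr_ge0 ?ltW ?gauss_pdf_gt0//; lra.
have : (fun x => - gauss_cdf x) x @[x --> -oo] --> (0 : R).
  by rewrite -oppr0; apply: cvgN; exact: gauss_cdf_cvgNy.
move/cvgr_to_le; apply; near=> x; apply: (@le_trans _ _ (D x)).
  by rewrite /D /= !fctE lerDr ltW// gauss_pdf_gt0.
by apply: ndD => //; near: x; exact: nbhs_ninfty_le.
Unshelve. all: by end_near. Qed.

Lemma gauss_cdf_taily w : 1 <= w -> 1 - gauss_cdf w <= gauss_pdf w.
Proof.
move=> w1; rewrite lerBlDr.
pose D := gauss_pdf + gauss_cdf.
have dD x : is_derive x 1 D ((1 - x) * gauss_pdf x).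
  have := is_derive_gauss_pdf x; have := is_derive_gauss_cdf x => ? ?.
  by apply: is_derive_eq; rewrite mulrBl mul1r mulNr addrC.
have cD : {within `[1, +oo[, continuous D}.
  by apply: derivable_within_continuous => x _; have [] := dD x.
have ndD x y : 1 <= x -> x <= y -> D y <= D x.
  apply: ler0_derive1_nincry => // z.
  rewrite in_itv/= andbT => z1; rewrite derive1E (@derive_val _ _ _ _ _ _ _ (dD z)).
  by rewrite mulr_le0_ge0 ?ltW ?gauss_pdf_gt0//; lra.
have /cvgr_to_le := gauss_cdf_cvgy; apply; near=> x; apply: (@le_trans _ _ (D x)).
  by rewrite /D /= !fctE lerDr ltW// gauss_pdf_gt0.
by apply: ndD => //; near: x; exact: nbhs_pinfty_ge.
Unshelve. all: by end_near. Qed.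

(** When the mean vanishes, the integral up to [w] is minus the integral beyond [w], so the right
    tail controls it as well. *)
Lemma gauss_prim_ccdf_le g w : measurable_fun setT g -> (forall x, `|g x| <= 1) ->
  gauss_mean g = 0 -> `|gauss_prim g w| <= 1 - gauss_cdf w.
Proof.
move=> mg g1; rewrite (gauss_mean_split w mg g1) => /eqP.
rewrite addr_eq0 => /eqP ->; rewrite normrN -gauss_mean1.
rewrite (@gauss_mean_split (fun=> 1) 1 w) => [|//|x]; last by rewrite normr1.
by rewrite addrAC subrr add0r; exact: norm_int_gauss_le.
Qed.

(** Each tail is handled by its Mills bound. Between -1 and 1 the integral is at most 1 while the
    density is at least [gauss_pdf 1]. *)
Lemma gauss_prim_pdf_le g w : measurable_fun setT g -> (forall x, `|g x| <= 1) ->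
  gauss_mean g = 0 -> `|gauss_prim g w| <= (1 + (gauss_pdf 1)^-1) * gauss_pdf w.
Proof.
move=> mg g1 g0; have gt1 := gauss_pdf_gt0 1; have gtw := gauss_pdf_gt0 w.
have ge0 : 0 <= (gauss_pdf 1)^-1 * gauss_pdf w.
  by apply: mulr_ge0; rewrite ?invr_ge0 ltW.
rewrite mulrDl mul1r.
have [w1|w1] := leP w (-1).
  apply: (le_trans (gauss_prim_cdf_le _ mg g1)).
  by apply: (le_trans (gauss_cdf_tailNy w1)); rewrite lerDl.
have [w2|w2] := leP 1 w.
  apply: (le_trans (gauss_prim_ccdf_le _ mg g1 g0)).
  by apply: (le_trans (gauss_cdf_taily w2)); rewrite lerDl.
apply: (@le_trans _ _ 1).
  apply: (le_trans (gauss_prim_cdf_le _ mg g1)).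
  by rewrite -lee_fin gauss_cdfE probability_le1.
apply: (@le_trans _ _ ((gauss_pdf 1)^-1 * gauss_pdf w)); last by rewrite lerDr ltW.
by rewrite mulrC ler_pdivlMr// mul1r le_gauss_pdf// ler_norml; lra.
Qed.

Lemma gauss_mean_itv h : measurable_fun setT h -> (forall x, 0 <= h x <= 1) ->
  0 <= gauss_mean h <= 1.
Proof.
move=> mh h01.
have h1 x : `|h x| <= 1 by have /andP[h0 ?] := h01 x; rewrite ger0_norm.
rewrite Rintegral_ge0/= => [|x _]; last first.
  by have /andP[h0 _] := h01 x; rewrite mulr_ge0// ltW// gauss_pdf_gt0.
rewrite -gauss_mean1 (le_trans (ler_norm _))//.
exact: norm_int_gauss_le.
Qed.

Lemma gauss_mean_center h : measurable_fun setT h -> (forall x, `|h x| <= 1) ->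
  gauss_mean (fun x => h x - gauss_mean h) = 0.
Proof.
move=> mh h1; set m := gauss_mean h; rewrite /gauss_mean.
transitivity (\int[mu]_x (h x * gauss_pdf x - m * gauss_pdf x)).
  by apply: eq_Rintegral => x _; rewrite mulrBl.
rewrite RintegralB//; last first.
- exact: (@integrable_mul_gauss_pdf (fun=> m) `|m|).
- exact: (@integrable_mul_gauss_pdf h 1).
rewrite RintegralZl//; last exact: integrable_gauss_pdf.
have := gauss_mean1; rewrite /gauss_mean.
under eq_Rintegral do rewrite mul1r.
by move=> ->; rewrite mulr1 subrr.
Qed.

(** The bounded solution of [f' w - w * f w = h w - gauss_mean h], obtained with the integrating
    factor [gauss_pdf]. *)
Definition stein_sol h w : R :=
  gauss_prim (fun x => h x - gauss_mean h) w / gauss_pdf w.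

(** * Regularity of the solution of the Stein equation *)

Section stein_sol.
Variable h : R -> R.
Hypotheses (ch : continuous h) (h01 : forall x, 0 <= h x <= 1).

Let mh : measurable_fun setT h := continuous_measurable_fun ch.

Let h1 x : `|h x| <= 1.
Proof. by have /andP[h0 ?] := h01 x; rewrite ger0_norm. Qed.

Let hm1 x : `|h x - gauss_mean h| <= 1.
Proof.
have := gauss_mean_itv mh h01; have := h01 x; rewrite ler_norml; lra.
Qed.

Lemma is_derive_stein_sol w :
  is_derive w 1 (stein_sol h) (w * stein_sol h w + (h w - gauss_mean h)).
Proof.
have cg : continuous (fun x => h x - gauss_mean h).
  by move=> x; apply: cvgB; [exact: ch|exact: cvg_cst].
have dF := is_derive_gauss_prim w cg hm1; have dp := is_derive_gauss_pdf w.
have p0 := gauss_pdf_gt0 w.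
have -> : stein_sol h = gauss_prim (fun x => h x - gauss_mean h) * (fun x => (gauss_pdf x)^-1).
  by [].
have dV := is_deriveV (lt0r_neq0 p0).
apply: is_derive_eq.
set F := gauss_prim _ _; set p := gauss_pdf w in p0 *; set g := h w - _.
change (F * (- (p ^+ 2)^-1 * (- w * p)) + p^-1 * (g * p) = w * (F * p^-1) + g).
by field; rewrite gt_eqF.
Qed.

Lemma stein_sol_bounded w : `|stein_sol h w| <= 1 + (gauss_pdf 1)^-1.
Proof.
have p0 := gauss_pdf_gt0 w.
rewrite /stein_sol normrM normfV (gtr0_norm p0) ler_pdivrMr//.
apply: gauss_prim_pdf_le => //; last exact: gauss_mean_center.
exact: measurable_funB.
Qed.

Let df w := w * stein_sol h w + (h w - gauss_mean h).

Variable L : R.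
Hypothesis hL : forall x y, `|h x - h y| <= L * `|x - y|.

(** The Stein equation expresses [df] through [f] and [h], so the bound on [f] and the Lipschitz
    constant of [h] make [df] locally Lipschitz, with a constant growing quadratically in [x]. The
    mean value theorem then gives the second order remainder. *)
Lemma stein_sol_taylor : exists2 C : R, 0 <= C & forall x u, `|u| <= 1 ->
  `|stein_sol h (x + u) - stein_sol h x - u * df x| <= C * (1 + x ^+ 2) * u ^+ 2 /\
  `|df (x + u) - df x| <= C * (1 + x ^+ 2) * `|u|.
Proof.
set f := stein_sol h; pose B : R := 1 + (gauss_pdf 1)^-1.
have B1 : 1 <= B by rewrite /B lerDl invr_ge0 ltW// gauss_pdf_gt0.
have fB x : `|f x| <= B := stein_sol_bounded x.
have L0 : 0 <= L.
  by have := hL 1 0; rewrite subr0 normr1 mulr1; exact: le_trans (normr_ge0 _).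
have dfB x : `|df x| <= B * `|x| + 1.
  apply: (le_trans (ler_normD _ _)); rewrite lerD// normrM mulrC.
  by rewrite ler_wpM2r.
have mvt x u := mean_value_real x u is_derive_stein_sol.
have lipf x u : `|u| <= 1 -> `|f (x + u) - f x| <= (B * (`|x| + 1) + 1) * `|u|.
  move=> u1; have [c cx ->] := mvt x u; rewrite normrM ler_wpM2r//.
  apply: (le_trans (dfB c)); rewrite lerD2r ler_wpM2l//; first lra.
  have := ler_normD (c - x) x; rewrite subrK; lra.
(* Large enough to absorb [B + t * (B * (t + 1) + 1) + L], where t is the absolute value of [x],
   once [2 * t <= 1 + t ^+ 2] is used. *)
pose C : R := 3 * B + L + 1.
have xx (x : R) : 2 * `|x| <= 1 + x ^+ 2.
  rewrite -(real_normK (num_real x)); have := sqr_ge0 (`|x| - 1); rewrite sqrrB1; lra.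
have lipdf x u : `|u| <= 1 -> `|df (x + u) - df x| <= C * (1 + x ^+ 2) * `|u|.
  move=> u1.
  have -> : df (x + u) - df x =
      u * f (x + u) + x * (f (x + u) - f x) + (h (x + u) - h x).
    by rewrite /df -/f; ring.
  have e1 : `|u * f (x + u)| <= B * `|u|.
    by rewrite normrM mulrC ler_wpM2r.
  have e2 : `|x * (f (x + u) - f x)| <= `|x| * (B * (`|x| + 1) + 1) * `|u|.
    by rewrite normrM -mulrA ler_wpM2l// lipf.
  have e3 : `|h (x + u) - h x| <= L * `|u|.
    by have := hL (x + u) x; rewrite addrAC subrr add0r.
  apply: (le_trans (ler_normD _ _)).
  apply: (@le_trans _ _ ((B + `|x| * (B * (`|x| + 1) + 1) + L) * `|u|)).
    rewrite 2!mulrDl lerD// (le_trans (ler_normD _ _))// lerD//.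
  rewrite ler_wpM2r// /C; have := xx x.
  rewrite -(real_normK (num_real x)); set t := `|x|.
  have t0 : 0 <= t := normr_ge0 _.
  have : 0 <= L * t ^+ 2 by rewrite mulr_ge0 ?sqr_ge0.
  nra.
exists C => [|x u u1]; first by rewrite /C; lra.
split; last exact: lipdf.
have [c cx ->] := mvt x u.
(* The remainder is now [u * (df c - df x)], and the Lipschitz bound applies with increment [c - x],
   no longer than [u]. *)
rewrite -/(df c) mulrC -mulrBr normrM.
have := lipdf x (c - x); rewrite (addrC x) subrK => /(_ (le_trans cx u1)) h'.
rewrite -(real_normK (num_real u)) expr2 mulrCA ler_wpM2l//.
apply: (le_trans h'); rewrite ler_wpM2l// mulr_ge0//; first by rewrite /C; lra.
by rewrite addr_ge0// sqr_ge0.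
Qed.

End stein_sol.
End gaussian.

(** * Random walks with finitely many steps *)

Section random_walk.
Context {R : realType} {K : finType}.
Variables p u : K -> R.
Implicit Types (f g h : R -> R) (x y : R).

(** [walk_step] and [walk_drift] are the operators U and A of the proof idea. For probability
    weights [p], [walk n g x] is the mean of [g] after n independent steps from [x]. *)
Definition walk_step g x : R := \sum_k p k * g (x + u k).
Definition walk_drift g x : R := \sum_k p k * u k * g (x + u k).
Definition walk n g : R -> R := iter n walk_step g.

Hypothesis p0 : forall k, 0 <= p k.

Lemma walk_stepD g h : walk_step (g \+ h) = walk_step g \+ walk_step h.
Proof.
by apply/funext => x; rewrite /walk_step /= -big_split; apply: eq_bigr => k _; rewrite mulrDr.
Qed.

Lemma walk_stepZ a g : walk_step (fun x => a * g x) = (fun x => a * walk_step g x).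
Proof.
by apply/funext => x; rewrite /walk_step mulr_sumr; apply: eq_bigr => k _; rewrite mulrCA.
Qed.

Lemma walkD n g h x : walk n (g \+ h) x = walk n g x + walk n h x.
Proof.
suff -> : walk n (g \+ h) = walk n g \+ walk n h by [].
by elim: n => //= n IH; rewrite -walk_stepD -IH.
Qed.

Lemma walkZ n a g x : walk n (fun y => a * g y) x = a * walk n g x.
Proof.
suff -> : walk n (fun y => a * g y) = (fun y => a * walk n g y) by [].
by elim: n => //= n IH; rewrite -walk_stepZ -IH.
Qed.

Lemma le_walk n g h x : (forall y, g y <= h y) -> walk n g x <= walk n h x.
Proof.
move=> gh; elim: n x => //= n IH x; apply: ler_sum => k _.
by rewrite ler_wpM2l// IH.
Qed.

Lemma norm_walk_le n g h x : (forall y, `|g y| <= h y) -> `|walk n g x| <= walk n h x.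
Proof.
move=> gh; elim: n x => //= n IH x; apply: (le_trans (ler_norm_sum _ _ _)).
by apply: ler_sum => k _; rewrite normrM ger0_norm// ler_wpM2l.
Qed.

Lemma walk_step_drift g : walk_step (walk_drift g) = walk_drift (walk_step g).
Proof.
apply/funext => x; rewrite /walk_step /walk_drift.
under eq_bigr do rewrite mulr_sumr.
under [RHS]eq_bigr do rewrite mulr_sumr.
rewrite exchange_big; apply: eq_bigr => k _; apply: eq_bigr => l _.
by rewrite (addrAC x); ring.
Qed.

(** Moving multiplication by [y] through one step costs one [walk_drift]. Since [walk_drift]
    commutes with [walk_step], the n+1 costs are all equal. *)
Lemma walk_mulX n g x : walk n.+1 (fun y => y * g y) x =
  x * walk n.+1 g x + n.+1%:R * walk n (walk_drift g) x.
Proof.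
have stepX f : walk_step (fun y => y * f y) = (fun y => y * walk_step f y) \+ walk_drift f.
  apply/funext => y; rewrite /walk_step /walk_drift /= mulr_sumr -big_split.
  by apply: eq_bigr => k _ /=; ring.
elim: n g x => [|n IH] g x; first by rewrite /walk /= stepX /= mul1r.
rewrite {1}/walk iterSr -/(walk _ _) stepX walkD IH.
rewrite -walk_step_drift.
have walkS m f : walk m (walk_step f) = walk m.+1 f by rewrite /walk iterSr.
by rewrite !walkS -[n.+2]addn1 natrD mulrDl mul1r addrA.
Qed.

Hypothesis p1 : \sum_k p k = 1.

Lemma walk_cst n a x : walk n (fun=> a) x = a.
Proof.
elim: n x => //= n IH x; rewrite /walk_step.
by under eq_bigr do rewrite IH; rewrite -mulr_suml p1 mul1r.
Qed.

Hypothesis pu0 : \sum_k p k * u k = 0.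

Lemma walk_sqr n x : walk n (fun y => y ^+ 2) x = x ^+ 2 + n%:R * \sum_k p k * u k ^+ 2.
Proof.
elim: n x => [|n IH] x; first by rewrite /walk /= mul0r addr0.
rewrite /walk iterS -/(walk _ _) /walk_step; under eq_bigr do rewrite IH.
set v := \sum_k p k * u k ^+ 2.
transitivity (\sum_k (x ^+ 2 * p k + 2 * x * (p k * u k) + p k * u k ^+ 2 + n%:R * v * p k)).
  by apply: eq_bigr => k _; ring.
by rewrite !big_split /= -!mulr_sumr p1 pu0 -/v -natr1; ring.
Qed.

Variables (n : nat) (f df : R -> R) (C e : R).
Hypothesis pu2 : \sum_k p k * u k ^+ 2 = n.+1%:R^-1.
Hypothesis ue : forall k, `|u k| <= e.
Hypothesis e1 : e <= 1.
Hypothesis C0 : 0 <= C.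
Hypothesis taylor : forall x y, `|y| <= 1 ->
  `|f (x + y) - f x - y * df x| <= C * (1 + x ^+ 2) * y ^+ 2 /\
  `|df (x + y) - df x| <= C * (1 + x ^+ 2) * `|y|.

(** By [walk_mulX] the quantity is [walk n] applied to [walk_step df - n.+1%:R * walk_drift f]. Both
    terms are within [C * (1 + x ^+ 2) * e] of [df], and the mean of [1 + y ^+ 2] after n steps is
    at most 2. *)
Lemma walk_stein : `|walk n.+1 (fun y => df y - y * f y) 0| <= 4 * C * e.
Proof.
have u1 k : `|u k| <= 1 := le_trans (ue k) e1.
have C1 x : 0 <= C * (1 + x ^+ 2) by rewrite mulr_ge0// addr_ge0// sqr_ge0.
have dfe x : `|walk_step df x - df x| <= C * (1 + x ^+ 2) * e.
  have -> : walk_step df x - df x = \sum_k p k * (df (x + u k) - df x).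
    under [RHS]eq_bigr do rewrite mulrBr.
    by rewrite sumrB -mulr_suml p1 mul1r.
  apply: (le_trans (ler_norm_sum _ _ _)).
  rewrite -[leRHS]mul1r -[X in _ <= X * _]p1 mulr_suml; apply: ler_sum => k _.
  rewrite normrM ger0_norm// ler_wpM2l// (le_trans (taylor x (u1 k)).2)//.
  by rewrite ler_wpM2l.
have de x : `|df x - n.+1%:R * walk_drift f x| <= C * (1 + x ^+ 2) * e.
  (* Centring ([pu0]) removes the constant Taylor term, and the variance [1 / n.+1] ([pu2]) turns
     the linear term into exactly [df x]. *)
  have -> : df x - n.+1%:R * walk_drift f x =
    - (n.+1%:R * \sum_k p k * u k * (f (x + u k) - f x - u k * df x)).
    transitivity (- (n.+1%:R * \sum_k (p k * u k * f (x + u k) -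
      f x * (p k * u k) - df x * (p k * u k ^+ 2)))); last first.
      by congr (- (_ * _)); apply: eq_bigr => k _; ring.
    rewrite !sumrB -!mulr_sumr pu0 pu2 -/(walk_drift f x).
    have : n.+1%:R != 0 :> R by rewrite pnatr_eq0.
    by move: (n.+1%:R : R) => N N0; field.
  rewrite normrN normrM ger0_norm// -ler_pdivlMl ?ltr0n//.
  apply: (le_trans (ler_norm_sum _ _ _)).
  rewrite -pu2 mulr_suml; apply: ler_sum => k _.
  rewrite !normrM ger0_norm// -!mulrA ler_wpM2l//.
  apply: (@le_trans _ _ (`|u k| * (C * (1 + x ^+ 2) * u k ^+ 2))).
    by rewrite ler_wpM2l// (taylor x (u1 k)).1.
  have -> : u k * (u k * (C * ((1 + x ^+ 2) * e))) = C * (1 + x ^+ 2) * u k ^+ 2 * e.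
    by ring.
  by rewrite mulrC ler_wpM2l// mulr_ge0// sqr_ge0.
have walkN m (g : R -> R) x : walk m (fun y => - g y) x = - walk m g x.
  rewrite -mulN1r -walkZ; congr (walk _ _ _).
  by apply/funext => y; rewrite mulN1r.
rewrite (walkD n.+1 df (fun y => - (y * f y))) walkN walk_mulX mul0r add0r.
rewrite {1}/walk iterSr -/(walk _ _) -walkZ -walkN -walkD.
apply: (@le_trans _ _ (walk n (fun y => 2 * C * e * (1 + y ^+ 2)) 0)).
  apply: norm_walk_le => y /=.
  have -> : walk_step df y - n.+1%:R * walk_drift f y =
    (walk_step df y - df y) + (df y - n.+1%:R * walk_drift f y) by ring.
  apply: (le_trans (ler_normD _ _)).
  have := dfe y; have := de y; lra.
rewrite walkZ (walkD n (fun=> 1) (fun y => y ^+ 2)) walk_cst walk_sqr pu2.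
rewrite expr0n /= add0r.
have n1 : n%:R / n.+1%:R <= 1 :> R.
  by rewrite ler_pdivrMr ?ltr0n// mul1r ler_nat.
move: n1; move: (n%:R / _) => q q1.
have e0 : 0 <= C * e.
  (* Weights summing to 1 force some step to exist, and its length shows [0 <= e]. *)
  have [k _|K0] := pickP K; first by rewrite mulr_ge0// (le_trans _ (ue k)).
  by move: p1 => /esym/eqP; rewrite big_pred0// oner_eq0.
nra.
Qed.

End random_walk.

(** * The central limit theorem for random walks *)

Section ramp.
Context {R : realType}.
Variables (r d : R).
Hypothesis d0 : 0 < d.
Implicit Types x y : R.

(** Equal to 1 up to [r], to 0 from [r + d] on, and affine in between: a Lipschitz function squeezed
    between the indicators of [x <= r] and [x <= r + d]. *)
Definition ramp x : R := Num.min 1 (Num.max 0 ((r + d - x) / d)).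

Lemma ramp01 x : 0 <= ramp x <= 1.
Proof. by rewrite /ramp le_min ler01 le_max lexx /= ge_min lexx. Qed.

Lemma ramp_lb x : (x <= r)%R%:R <= ramp x.
Proof.
case: (leP x r) => [xr|_]; last by have /andP[] := ramp01 x.
by rewrite /ramp le_min lexx le_max ler_pdivlMr// mul1r orbC lerBrDr addrC lerD2r xr.
Qed.

Lemma ramp_ub x : ramp x <= (x <= r + d)%R%:R.
Proof.
case: (leP x (r + d)) => [_|xr]; first by have /andP[] := ramp01 x.
rewrite /ramp ge_min ge_max lexx /= orbC.
by rewrite ler_pdivrMr// mul0r subr_le0 ltW.
Qed.

Lemma ramp_lip x y : `|ramp x - ramp y| <= d^-1 * `|x - y|.
Proof.
wlog xy : x y / x <= y.
  move=> W; have [/W//|/ltW/W] := leP x y.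
  by rewrite distrC (distrC y).
rewrite (ler0_norm (_ : x - y <= 0)) ?subr_le0// opprB.
have ryx : ramp y <= ramp x.
  have le : (r + d - y) / d <= (r + d - x) / d by rewrite ler_pM2r ?invr_gt0//; lra.
  rewrite /ramp; move: ((r + d - y) / d) ((r + d - x) / d) le => a b ab.
  case: (leP 0 a) => a0; case: (leP 0 b) => b0; rewrite /Order.min; do ! case: ifP => ?; lra.
rewrite ger0_norm ?subr_ge0// lerBlDr.
have e : (r + d - x) / d = d^-1 * (y - x) + (r + d - y) / d.
  by field; rewrite gt_eqF.
have p : 0 <= d^-1 * (y - x) by rewrite mulr_ge0 ?subr_ge0// invr_ge0 ltW.
rewrite /ramp e; move: (d^-1 * (y - x)) p ((r + d - y) / d) => a a0 b.
case: (leP 0 b) => b0; case: (leP 0 (a + b)) => ab; rewrite /Order.min; do ! case: ifP => ?; lra.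
Qed.

Lemma continuous_ramp : continuous ramp.
Proof.
move=> x; apply/cvgrPdist_lt => e e0; near=> y.
apply: (le_lt_trans (ramp_lip _ _)); rewrite ltr_pdivrMl//.
near: y; apply: cvgr_dist_lt; [exact: cvg_id|exact: mulr_gt0].
Unshelve. all: by end_near. Qed.

Let mr : measurable_fun setT ramp := continuous_measurable_fun continuous_ramp.

Let ramp1 x : `|ramp x| <= 1.
Proof. by have /andP[h0 ?] := ramp01 x; rewrite ger0_norm. Qed.

Lemma gauss_mean_ramp_ge : gauss_cdf r <= gauss_mean ramp.
Proof.
rewrite (gauss_mean_split r mr ramp1) -[leLHS]addr0 lerD//; last first.
  apply: Rintegral_ge0 => x _; have /andP[h0 _] := ramp01 x.
  by rewrite mulr_ge0// ltW// gauss_pdf_gt0.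
rewrite le_eqVlt; apply/orP; left; apply/eqP.
apply: eq_Rintegral => x; rewrite inE /= in_itv /= => xr.
have := ramp_lb x; rewrite xr => x1; congr (_ * _); apply/esym/le_anti.
by rewrite x1 andbT; have /andP[] := ramp01 x.
Qed.

Lemma gauss_mean_ramp_le : gauss_mean ramp <= gauss_cdf (r + d).
Proof.
rewrite (gauss_mean_split (r + d) mr ramp1) -[leRHS]addr0 lerD//.
  by apply: (le_trans (ler_norm _)); exact: gauss_prim_cdf_le.
rewrite le_eqVlt; apply/orP; left; apply/eqP.
transitivity (\int[lebesgue_measure]_(x in `]r + d, +oo[) (0 : R)); last first.
  by rewrite Rintegral_cst// mul0r.
apply: eq_Rintegral => x; rewrite inE /= in_itv /= andbT => xr.
have := ramp_ub x; rewrite (leNgt x) xr /= => x1; rewrite (_ : ramp x = 0) ?mul0r//.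
by apply/le_anti; rewrite x1 /=; have /andP[] := ramp01 x.
Qed.

End ramp.

(** * Convergence of the rescaled walk to the Gaussian law *)

Section walk_limit.
Context {R : realType} {K : finType}.
Variables p v : K -> R.
Hypothesis p0 : forall k, 0 <= p k.
Hypothesis p1 : \sum_k p k = 1.
Hypothesis pv0 : \sum_k p k * v k = 0.
Hypothesis pv2 : \sum_k p k * v k ^+ 2 = 1.

Let u n k : R := v k / Num.sqrt n%:R.

(** The Stein equation rewrites the error as the quantity of [walk_stein], with
    [e = M / Num.sqrt n%:R], where [M] bounds all values of [v]. *)
Lemma walk_mean_cvg (h : R -> R) (L : R) : (forall x, 0 <= h x <= 1) ->
  continuous h -> (forall x y, `|h x - h y| <= L * `|x - y|) ->
  walk p (u n) n h 0 @[n --> \oo] --> gauss_mean h.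
Proof.
move=> h01 ch hL; have [C C0 taylor] := stein_sol_taylor ch h01 hL.
pose M : R := \sum_k `|v k|.
have M0 : 0 <= M by apply: sumr_ge0.
have vM k : `|v k| <= M by rewrite /M (bigD1 k)//= lerDl sumr_ge0.
have bound n : (0 < n)%N -> M / Num.sqrt n%:R <= 1 ->
    `|walk p (u n) n h 0 - gauss_mean h| <= 4 * C * (M / Num.sqrt n%:R).
  case: n => // n _ Mn; have sn : 0 < Num.sqrt (n.+1%:R : R) by rewrite sqrtr_gt0 ltr0n.
  have pu0 : \sum_k p k * u n.+1 k = 0.
    by under eq_bigr do rewrite mulrA; rewrite -mulr_suml pv0 mul0r.
  have pu2 : \sum_k p k * u n.+1 k ^+ 2 = n.+1%:R^-1.
    under eq_bigr do rewrite exprMn exprVn sqr_sqrtr ?ler0n// mulrA.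
    by rewrite -mulr_suml pv2 mul1r.
  have ue k : `|u n.+1 k| <= M / Num.sqrt n.+1%:R.
    by rewrite normrM normfV (gtr0_norm sn) ler_pM2r// invr_gt0.
  have := walk_stein p0 p1 pu0 pu2 ue Mn C0 taylor.
  (* This is the Stein equation: [df y - y * f y] equals [h y - gauss_mean h]. *)
  rewrite (_ : (fun y => _) = h \+ (fun=> - gauss_mean h)).
    by rewrite walkD walk_cst.
  by apply/funext => y /=; ring.
have M2 : M / Num.sqrt n%:R @[n --> \oo] --> (0 : R).
  rewrite -[0 : R](mulr0 M); apply: cvgMr.
  apply/cvgrPdist_le => e e0; near=> n.
  rewrite sub0r normrN ger0_norm ?invr_ge0// -[leRHS]invrK lef_pV2 ?posrE ?invr_gt0//; last first.
    by rewrite sqrtr_gt0 ltr0n; near: n; exists 1%N.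
  rewrite -[leLHS]ger0_norm ?invr_ge0 ?(ltW e0)// -sqrtr_sqr; apply: ler_wsqrtr.
  by near: n; exact: nbhs_infty_ger.
have sqrtoo : 4 * C * (M / Num.sqrt n%:R) @[n --> \oo] --> (0 : R).
  by rewrite -[0 : R](mulr0 (4 * C)); apply: cvgMr.
have M1 : \forall n \near \oo, M / Num.sqrt (n%:R : R) <= 1.
  by move/cvgr_le : M2; apply; exact: ltr01.
apply/cvgrPdist_le => e e0; near=> n.
have n0 : (0 < n)%N by near: n; exists 1%N.
rewrite distrC; apply: (@le_trans _ _ (4 * C * (M / Num.sqrt n%:R))).
  by apply: bound => //; near: n.
by near: n; move/cvgr_le : sqrtoo; exact.
Unshelve. all: by end_near. Qed.

(** The indicator lies between the ramps starting at [r - d] and at [r]. Their Gaussian means lie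
    above [gauss_cdf (r - d)] and below [gauss_cdf (r + d)] respectively, and continuity of
    [gauss_cdf] makes these close for small [d]. *)
Lemma walk_cdf_cvg r :
  walk p (u n) n (fun x => (x <= r)%R%:R) 0 @[n --> \oo] --> gauss_cdf r.
Proof.
have cc : {for r, continuous gauss_cdf}.
  by apply: differentiable_continuous; apply/derivable1_diffP; have [] := is_derive_gauss_cdf r.
apply/cvgrPdist_le => e e0.
have e20 : 0 < e / 2 by rewrite divr_gt0.
have [d /= d0 hd] : exists2 d : R, 0 < d & 
    forall y, `|r - y| <= d -> `|gauss_cdf r - gauss_cdf y| <= e / 2.
  have /cvgrPdist_le /(_ _ e20) [d /= d0 hd] := cc.
  exists (d / 2); first by rewrite divr_gt0.
  by move=> y ry; apply: hd => /=; apply: (le_lt_trans ry); rewrite ltr_pdivrMr// ltr_pMr// ltr1n.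
have dm : d != 0 by rewrite gt_eqF.
have lim1 := walk_mean_cvg (ramp01 r d) (@continuous_ramp R r d d0) (@ramp_lip R r d d0).
have lim2 := walk_mean_cvg (ramp01 (r - d) d) (@continuous_ramp R (r - d) d d0)
  (@ramp_lip R (r - d) d d0).
have h1 : `|gauss_cdf r - gauss_cdf (r - d)| <= e / 2.
  by apply: hd; rewrite subKr gtr0_norm.
have h2 : `|gauss_cdf r - gauss_cdf (r + d)| <= e / 2.
  by apply: hd; rewrite opprD addrA subrr add0r normrN gtr0_norm.
have m1 := @gauss_mean_ramp_le R r d d0; have m2 := @gauss_mean_ramp_ge R (r - d) d d0.
move/cvgrPdist_le : lim1 => /(_ _ e20) lim1; move/cvgrPdist_le : lim2 => /(_ _ e20) lim2.
near=> n.
have : `|gauss_mean (ramp r d) - walk p (u n) n (ramp r d) 0| <= e / 2 by near: n.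
have : `|gauss_mean (ramp (r - d) d) - walk p (u n) n (ramp (r - d) d) 0| <= e / 2 by near: n.
have : walk p (u n) n (fun x => (x <= r)%R%:R) 0 <= walk p (u n) n (ramp r d) 0.
  by apply: le_walk => // y; exact: ramp_lb.
have : walk p (u n) n (ramp (r - d) d) 0 <= walk p (u n) n (fun x => (x <= r)%R%:R) 0.
  by apply: le_walk => // y; rewrite -[in leRHS](subrK d r); exact: ramp_ub.
move: h1 h2; rewrite !ler_norml; lra.
Unshelve. all: by end_near. Qed.

End walk_limit.

(** * The law of a sum of independent finitely valued variables *)

Lemma measurable_natnat (A : set (nat * nat)) : measurable A.
Proof.
apply: countable_measurable; last exact: countableP.
move=> [a b]; have -> : [set (a, b)] = [set a] `*` [set b].
  by apply/seteqP; split => [z -> //|[? ?] /= [-> ->]].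
exact: measurableX.
Qed.

Section finite_valued.
Context d (Om : measurableType d) (R : realType) (P : probability Om R).
Context {K : finType}.

Lemma probability_partition (D : Om -> K) (E : set Om) :
  (forall k, measurable (D @^-1` [set k])) -> measurable E ->
  fine (P E) = \sum_k fine (P (E `&` D @^-1` [set k])).
Proof.
move=> mD mE.
have {1}-> : E = \bigcup_(k in [set` enum K]) (E `&` D @^-1` [set k]).
  apply/seteqP; split => [w Ew|w [k _ []//]].
  by exists (D w) => //=; rewrite mem_enum.
have mED k : measurable (E `&` D @^-1` [set k]) by exact: measurableI.
rewrite measure_fin_bigcup//; last first.
  apply/trivIsetP => i j _ _ /eqP ij; rewrite -subset0 => w [[_ /= wi] [_ /= wj]].
  by apply: ij; rewrite -wi.
rewrite -fsbig_seq ?enum_uniq// big_enum /= sum_fine// => k _.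
by rewrite fin_num_measure.
Qed.

Context d' (U : measurableType d') (V : nat -> {RV P >-> U}) (code : U -> K).
Hypothesis mcode : forall k, measurable (code @^-1` [set k]).
Variable p : K -> R.
Hypothesis pE : forall i k, fine (P (V i @^-1` (code @^-1` [set k]))) = p k.
Hypothesis indepV : mutually_independent_RVs V.

Let mV i k : measurable (V i @^-1` (code @^-1` [set k])).
Proof. by rewrite -[X in measurable X]setTI; exact: measurable_funPT. Qed.

(* The cylinder event over indices at least n is there for the induction on n:
   conditioning on the value of the last summand enlarges it. *)
Lemma probability_walk_cylinder (u : K -> R) (B : R -> bool) n :
  forall (J : {fset nat}) (A : nat -> set U) x, (forall i, measurable (A i)) ->
  (forall j, j \in J -> (n <= j)%N) ->
  fine (P (\bigcap_(i in [set` J]) (V i @^-1` A i) `&`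
    [set w | B (x + \sum_(i < n) u (code (V i w)))])) =
  fine (P (\bigcap_(i in [set` J]) (V i @^-1` A i))) *
  walk p u n (fun y => (B y)%:R) x.
Proof.
have mBn m x : measurable [set w | B (x + \sum_(i < m) u (code (V i w)))].
  elim: m x => [|m IHm] x.
    under eq_set do rewrite big_ord0 addr0.
    case: (B x).
      by rewrite (_ : [set _ | _] = setT)//; apply/seteqP; split.
    by rewrite (_ : [set _ | _] = set0)//; apply/seteqP; split => w.
  rewrite (_ : [set w | _] =
      \bigcup_(k in [set` enum K]) (V m @^-1` (code @^-1` [set k]) `&`
      [set w | B (x + u k + \sum_(i < m) u (code (V i w)))])).
    apply: fin_bigcup_measurable => // k _; exact: measurableI.
  apply/seteqP; split => w /=.
    rewrite big_ord_recr /= addrCA addrC => Bw.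
    by exists (code (V m w)); rewrite /= ?mem_enum.
  by move=> [k _ [/= <-]]; rewrite big_ord_recr /= addrAC addrA.
elim: n => [|n IH] J A x mA hJ.
  rewrite /walk /= (_ : [set w | B _] = [set w : Om | B x]); last first.
    by apply/seteqP; split => w /=; rewrite big_ord0 addr0.
  case: (B x).
    by rewrite mulr1; congr (fine (P _)); apply/seteqP; split => [w []|w].
  rewrite mulr0 (_ : _ `&` _ = set0) ?measure0//.
  by apply/seteqP; split => [w []|w].
set C := \bigcap_(i in _) _.
have mC : measurable C.
  apply: fin_bigcap_measurable => // i _.
  by rewrite -[X in measurable X]setTI; exact: measurable_funPT.
rewrite (probability_partition (mV n)); last exact: measurableI.
rewrite /walk iterS -/(walk _ _ _ _) /walk_step mulr_sumr; apply: eq_bigr => k _.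
have nJ : n \notin J by apply/negP => /hJ; rewrite ltnn.
(* The event that summand n has code [k] joins the cylinder as a new coordinate; [J] holds only
   indices above n, so independence factors out [p k]. *)
pose A' i := if i == n then code @^-1` [set k] else A i.
have CE : \bigcap_(i in [set` (n |` J)%fset]) (V i @^-1` A' i) =
    V n @^-1` (code @^-1` [set k]) `&` C.
  rewrite bigcap_fsetU1 /A' eqxx; congr (_ `&` _).
  apply: eq_bigcapr => i /= iJ; case: eqP => // ie.
  by move: nJ; rewrite -ie iJ.
have mA' i : measurable (A' i) by rewrite /A'; case: ifP.
have PCE : fine (P (V n @^-1` (code @^-1` [set k]) `&` C)) = p k * fine (P C).
  rewrite -CE indepV// big_fsetU1//= {1}/A' eqxx.
  have -> : (\prod_(i <- J) P (V i @^-1` A' i))%E = P C.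
    rewrite /C indepV//; apply: eq_big_seq => i iJ; rewrite /A'; case: eqP => // ie.
    by move: nJ; rewrite -ie iJ.
  by rewrite fineM ?fin_num_measure// pE.
rewrite mulrA (mulrC _ (p k)) -PCE -CE -IH//; last first.
  by move=> j; rewrite in_fset1U => /orP[/eqP -> //|/hJ /ltnW].
congr (fine (P _)); rewrite CE; apply/seteqP; split => w /=.
  move=> [[Cw]]; rewrite big_ord_recr /= => + <-.
  by rewrite addrCA addrC.
move=> [[<- Cw] Bw]; do ! split => //.
by move: Bw; rewrite big_ord_recr /= addrAC addrA.
Qed.

Lemma probability_walk (u : K -> R) (B : R -> bool) n :
  fine (P [set w | B (\sum_(i < n) u (code (V i w)))]) =
  walk p u n (fun y => (B y)%:R) 0.
Proof.
have := @probability_walk_cylinder u B n fset0 (fun=> setT) 0 (fun=> measurableT).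
rewrite set_fset0 bigcap_set0 setTI probability_setT mul1r => <- //.
by congr (fine (P _)); apply/seteqP; split => w /=; rewrite add0r.
Qed.

End finite_valued.

(** * The truncated and censored geometric sample *)

Section geometric_tail.
Context d (Om : measurableType d) (R : realType) (P : probability Om R).
Variables (theta : R) (X : {RV P >-> nat}).
Hypothesis theta01 : 0 < theta < 1.
Hypothesis geomX : geometric_RV theta X.

Let mX (A : set nat) : measurable (X @^-1` A).
Proof. by rewrite -[X in measurable X]setTI; exact: measurable_funPT. Qed.

Let tailS x : (1 <= x)%N -> fine (P (X @^-1` [set y | (x <= y)%N])) =
  theta * (1 - theta) ^+ x.-1 + fine (P (X @^-1` [set y | (x < y)%N])).
Proof.
move=> x1; rewrite (_ : X @^-1` [set y | (x <= y)%N] =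
    X @^-1` [set x] `|` X @^-1` [set y | (x < y)%N]); last first.
  rewrite -preimage_setU; congr (_ @^-1` _); apply/seteqP; split => y /=.
    by rewrite leq_eqVlt => /orP[/eqP ->|]; [left|right].
  by move=> [-> //|]; exact: ltnW.
rewrite measureU//; last first.
  rewrite -preimage_setI -[RHS](preimage_set0 X); congr (_ @^-1` _).
  by apply/seteqP; split => y //= [->]; rewrite ltnn.
by rewrite fineD ?fin_num_measure// [X in fine X + _]geomX.
Qed.

(** [geometric_RV] prescribes only the point masses at [x >= 1], so that X is almost surely at least
    1 has to be derived: these masses sum to 1. Subtracting the first ones then gives the tail. *)
Lemma geometric_tail x : (1 <= x)%N ->
  fine (P (X @^-1` [set y | (x <= y)%N])) = (1 - theta) ^+ x.-1.
Proof.
have /andP[t0 t1] := theta01.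
pose a x := fine (P (X @^-1` [set y | (x <= y)%N])).
have aS n : a 1%N = 1 - (1 - theta) ^+ n + a n.+1.
  elim: n => [|n ->]; first by rewrite expr0 subrr add0r.
  by rewrite {1}/a tailS// -/(a n.+2) exprS /=; ring.
have a1 : a 1%N = 1.
  apply/le_anti/andP; split.
    by rewrite /a -lee_fin fineK ?fin_num_measure// probability_le1.
  have : 1 - (1 - theta) ^+ n @[n --> \oo] --> (1 : R).
    rewrite -[X in _ --> X]subr0; apply: cvgB; first exact: cvg_cst.
    by apply: cvg_expr; rewrite ger0_norm; lra.
  move/cvgr_to_le; apply; near=> n.
  by rewrite (aS n) lerDl /a fine_ge0.
case: x => // n _; have := aS n; rewrite a1 /= -/(a n.+1); lra.
Unshelve. all: by end_near. Qed.

End geometric_tail.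

(** * Mean and variance of the compensated counting process of one unit *)

Section moments.
Context {R : realType} {N : nat}.
Local Notation K := ('I_N.+1 * 'I_N.+1)%type.
Variables (theta : R) (s : nat) (p : K -> R).
(** The constant hazard of the geometric law, weighted by an arbitrary event on T; it is what makes
    the increments below martingale differences. *)
Hypothesis hp : forall (b : pred nat) x, (1 <= x < N)%N ->
  \sum_k p k * ((b k.2) && (k.1 == x :> nat))%:R =
  theta * \sum_k p k * ((b k.2) && (x <= k.1)%N)%:R.

(* The increment at x of the compensated counting process of a unit with
   (X, T) = z. *)
Definition mart_inc x (z : nat * nat) : R :=
  (z.2 < x <= z.2 + s)%N%:R * ((z.1 == x)%:R - theta * (x <= z.1)%N%:R).

Definition mart_sum (z : nat * nat) : R := \sum_(1 <= x < N) mart_inc x z.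

Let nz (k : K) : nat * nat := (k.1 : nat, k.2 : nat).

Lemma sum_mart_inc (b : pred nat) x : (1 <= x < N)%N ->
  \sum_k p k * ((b k.2)%:R * mart_inc x (nz k)) = 0.
Proof.
move=> xN; pose b' t := b t && (t < x <= t + s)%N.
transitivity (\sum_k (p k * ((b' k.2) && (k.1 == x :> nat))%:R -
    theta * (p k * ((b' k.2) && (x <= k.1)%N)%:R))).
  apply: eq_bigr => k _; rewrite /mart_inc /b' /= -!mulnb !natrM; ring.
by rewrite sumrB -mulr_sumr hp// subrr.
Qed.

Lemma sum_mart_sum : \sum_k p k * mart_sum (nz k) = 0.
Proof.
under eq_bigr do rewrite mulr_sumr.
rewrite exchange_big big_nat big1//= => x xN.
have := @sum_mart_inc xpredT x xN.
by move=> h; rewrite -[RHS]h; apply: eq_bigr => k _; rewrite /= mul1r.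
Qed.

(** If X is below [y], the later increment vanishes; otherwise the earlier one is [- theta] times an
    indicator depending on T alone. The product thus has mean zero by [sum_mart_inc]. *)
Lemma sum_mart_inc_mul x y : (1 <= x)%N -> (x < y < N)%N ->
  \sum_k p k * (mart_inc x (nz k) * mart_inc y (nz k)) = 0.
Proof.
move=> x1 /andP[xy yN].
have yN' : (1 <= y < N)%N by rewrite yN (leq_trans x1 (ltnW xy)).
have h := @sum_mart_inc (fun t => t < x <= t + s)%N y yN'.
rewrite -[RHS](mulr0 (- theta)) -[X in _ = _ * X]h mulr_sumr.
apply: eq_bigr => k _; rewrite /mart_inc /nz /=.
have [yk|ky] := leqP y k.1.
  have -> : (k.1 == x :> nat) = false by apply/eqP; lia.
  have -> : (x <= k.1)%N by lia.
  by rewrite /=; ring.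
have -> : (k.1 == y :> nat) = false by apply/eqP; lia.
by rewrite /=; ring.
Qed.

(** The square of the bracket in [mart_inc] is [1 - 2 * theta] times the indicator of X = x plus
    [theta ^+ 2] times that of x <= X. The hazard relation merges the coefficients into
    [theta * (1 - theta)]. *)
Lemma sum_mart_inc_sqr x : (1 <= x < N)%N ->
  \sum_k p k * mart_inc x (nz k) ^+ 2 =
  theta * (1 - theta) * \sum_k p k * ((k.2 < x <= k.2 + s) && (x <= k.1))%N%:R.
Proof.
move=> xN; pose b t := (t < x <= t + s)%N.
pose S := \sum_k p k * ((b k.2) && (k.1 == x :> nat))%:R.
pose Q := \sum_k p k * ((b k.2) && (x <= k.1)%N)%:R.
have hS : S = theta * Q := @hp b x xN.
rewrite -[X in _ = _ * X]/Q.
transitivity ((1 - 2 * theta) * S + theta ^+ 2 * Q); last by rewrite hS; ring.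
rewrite /S /Q 2!mulr_sumr -big_split; apply: eq_bigr => k _ /=.
rewrite /mart_inc /nz /= /b; case: (k.2 < x <= k.2 + s)%N => /=; last by ring.
have [kx|kx] := eqVneq (k.1 : nat) x; first by rewrite kx leqnn /=; ring.
by case: leqP => ? /=; ring.
Qed.

Lemma sum_mart_sum_sqr : \sum_k p k * mart_sum (nz k) ^+ 2 =
  theta * (1 - theta) * \sum_(1 <= x < N)
    \sum_k p k * ((k.2 < x <= k.2 + s) && (x <= k.1))%N%:R.
Proof.
transitivity (\sum_(1 <= x < N) \sum_(1 <= y < N)
    \sum_k p k * (mart_inc x (nz k) * mart_inc y (nz k))).
  under [RHS]eq_bigr do rewrite exchange_big.
  rewrite exchange_big; apply: eq_bigr => k _ /=.
  rewrite expr2 /mart_sum mulr_suml mulr_sumr; apply: eq_bigr => x _.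
  by rewrite !mulr_sumr.
rewrite mulr_sumr; apply: eq_big_nat => x xN.
rewrite (bigD1_seq x) ?iota_uniq ?mem_index_iota//=.
rewrite -[RHS]addr0 -sum_mart_inc_sqr//; congr (_ + _).
rewrite big_seq_cond big1// => y; rewrite mem_index_iota => /andP[yN yx].
have [xy|xy] := ltnP x y; first by apply: sum_mart_inc_mul; lia.
under eq_bigr do rewrite (mulrC (mart_inc x _)).
apply: sum_mart_inc_mul; first lia.
by rewrite ltn_neqAle yx xy; lia.
Qed.

End moments.

(** * Reduction of the sample to finitely many values *)

Section truncation.
Context d (Om : measurableType d) (R : realType) (P : probability Om R).
Variables (G s : nat) (theta : R) (X T : nat -> {RV P >-> nat}).
Hypothesis geomX : geometric_RV theta (X 0%N).
Hypothesis rangeT : forall i w, (T i w < G)%N.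
Hypothesis indepXT : independent_RVs (X 0%N) (T 0%N).

Local Notation N := (s + G)%N.
Local Notation K := ('I_N.+1 * 'I_N.+1)%type.
Local Notation V := (fun i : nat => pair_RV (X i) (T i)).

(* For x < s + G the events X = x and x <= X depend only on the truncation of X
   at s + G, so truncating makes the sample finitely valued at no cost. *)
Definition trunc_code (z : nat * nat) : K :=
  (inord (minn z.1 N), inord (minn z.2 N)).

Arguments trunc_code : simpl never.

Definition code_prob (k : K) : R :=
  fine (P (V 0%N @^-1` (trunc_code @^-1` [set k]))).

Lemma trunc_codeE z :
  ((trunc_code z).1 = minn z.1 N :> nat) * ((trunc_code z).2 = minn z.2 N :> nat).
Proof. by rewrite /trunc_code /= !inordK// ltnS geq_minr. Qed.

Let mV i (A : set (nat * nat)) : measurable (V i @^-1` A).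
Proof.
rewrite -[X in measurable X]setTI.
by apply: measurable_pair_RV => //; exact: measurable_natnat.
Qed.

Lemma sum_code_prob (e : pred K) :
  \sum_k code_prob k * (e k)%:R = fine (P [set w | e (trunc_code (V 0%N w))]).
Proof.
rewrite (@probability_partition _ _ _ P _ (trunc_code \o V 0%N)) => [|k|]; last 2 first.
- exact: (mV 0%N (trunc_code @^-1` [set k])).
- exact: (mV 0%N [set z | e (trunc_code z)]).
apply: eq_bigr => k _; case: (boolP (e k)) => ek.
  rewrite mulr1 /code_prob; congr (fine (P _)); apply/seteqP; split => w /=.
    by move=> wk; split => //=; rewrite wk.
  by case.
rewrite mulr0 (_ : _ `&` _ = set0) ?measure0//; apply/seteqP; split => w // [] /=.
by move=> + wk; rewrite wk (negbTE ek).
Qed.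

Lemma sum_code_prob1 : \sum_k code_prob k = 1.
Proof.
have := sum_code_prob xpredT; rewrite (_ : [set w | _] = setT); last by apply/seteqP; split.
rewrite probability_setT => h; rewrite -[RHS]h; apply: eq_bigr => k _.
by rewrite mulr1.
Qed.

Lemma code_prob_ge0 k : 0 <= code_prob k.
Proof. exact: fine_ge0. Qed.

Let mRV (Y : {RV P >-> nat}) (A : set nat) : measurable (Y @^-1` A).
Proof. by rewrite -[X in measurable X]setTI; exact: measurable_funPT. Qed.

Lemma probability_indep (b c : pred nat) :
  fine (P [set w | b (T 0%N w) && c (X 0%N w)]) =
  fine (P (T 0%N @^-1` [set t | b t])) * fine (P (X 0%N @^-1` [set x | c x])).
Proof.
rewrite mulrC -fineM ?fin_num_measure// -indepXT//.
by congr (fine (P _)); apply/seteqP; split => w /= => [/andP[]|[]] -> ->.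
Qed.

Lemma sum_code_eq (b : pred nat) x : (1 <= x < N)%N ->
  \sum_k code_prob k * ((b k.2) && (k.1 == x :> nat))%:R =
  fine (P (T 0%N @^-1` [set t | b t])) * (theta * (1 - theta) ^+ x.-1).
Proof.
move=> /andP[x1 xN].
rewrite (sum_code_prob (fun k => b k.2 && (k.1 == x :> nat))).
have := probability_indep b (pred1 x).
rewrite [X in _ = _ * fine X](_ : _ = (theta * (1 - theta) ^+ x.-1)%:E); last first.
  by rewrite -geomX//; congr (P _); apply/seteqP; split => w /= /eqP.
move=> <-; congr (fine (P _)); apply/seteqP; split => w; rewrite /mkset !trunc_codeE /pair_RV /=;
  have := rangeT 0 w; move: (T 0%N w) (X 0%N w) => t y tG;
  rewrite (minn_idPl (_ : t <= N)%N) ?(leq_trans (ltnW tG)) ?leq_addl// => /andP[-> /=]; lia.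
Qed.

Lemma sum_code_ge (b : pred nat) x : 0 < theta < 1 -> (1 <= x < N)%N ->
  \sum_k code_prob k * ((b k.2) && (x <= k.1)%N)%:R =
  fine (P (T 0%N @^-1` [set t | b t])) * (1 - theta) ^+ x.-1.
Proof.
move=> theta01 /andP[x1 xN].
rewrite (sum_code_prob (fun k => b k.2 && (x <= k.1)%N)).
rewrite -(geometric_tail theta01 geomX x1) -probability_indep.
congr (fine (P _)); apply/seteqP; split => w; rewrite /mkset !trunc_codeE /pair_RV /=;
  have := rangeT 0 w; move: (T 0%N w) (X 0%N w) => t y tG;
  rewrite (minn_idPl (_ : t <= N)%N) ?(leq_trans (ltnW tG)) ?leq_addl// => /andP[-> /=]; lia.
Qed.

Lemma sum_code_eq_ge (b : pred nat) x : 0 < theta < 1 -> (1 <= x < N)%N ->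
  \sum_k code_prob k * ((b k.2) && (k.1 == x :> nat))%:R =
  theta * \sum_k code_prob k * ((b k.2) && (x <= k.1)%N)%:R.
Proof. by move=> theta01 xN; rewrite sum_code_eq// sum_code_ge// mulrCA. Qed.

(** At time x-1 the unit is at risk when T < x <= T + s and x <= X; as x < s + G, truncation
    preserves these conditions. *)
Lemma expectation_at_risk x : (1 <= x < N)%N ->
  fine 'E_P[at_risk s (X 0%N) (T 0%N) x.-1] =
  \sum_k code_prob k * ((k.2 < x <= k.2 + s) && (x <= k.1))%N%:R.
Proof.
move=> /andP[x1 xN]; rewrite (sum_code_prob (fun k => (k.2 < x <= k.2 + s) && (x <= k.1))%N).
set E := [set w | _]; have mE : measurable E.
  exact: (mV 0%N [set z | ((trunc_code z).2 < x <= (trunc_code z).2 + s) &&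
    (x <= (trunc_code z).1)]%N).
rewrite -expectation_indic//; congr (fine (expectation P _)); apply/funext => w.
rewrite indicE /E /at_risk prednK//; congr (_%:R); congr nat_of_bool.
apply/idP/idP; rewrite inE /mkset !trunc_codeE /pair_RV /=.
  by have := rangeT 0 w; lia.
by have := rangeT 0 w; lia.
Qed.

(** Some [t < G] is taken by T with positive probability. A unit with T = t enters the risk set at
    time t if X > t, so the summand at [t.+1] is positive. *)
Lemma PB_sigma2_gt0 : 0 < theta < 1 -> (1 <= s)%N ->
  0 < PB_sigma2 G s theta X T.
Proof.
move=> theta01 s1; have /andP[t0 t1] := theta01.
have [t Pt] : exists t : 'I_N.+1, fine (P (T 0%N @^-1` [set (t : nat)])) != 0.
  apply: contrapT => /forallNP noT.
  (* If every value of T had probability zero, the finite partition by these values would give total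
     mass zero. *)
  have : fine (P setT) = 0.
    rewrite (@probability_partition _ _ _ P _ (fun w => inord (T 0%N w) : 'I_N.+1))//.
      rewrite big1// => k _; have /negP := noT k; rewrite negbK => /eqP h.
      rewrite -[RHS]h setTI; congr (fine (P _)); apply/seteqP; split => w /=.
        by move=> <-; rewrite inordK//; have := rangeT 0 w; lia.
      by move=> ->; rewrite inord_val.
    by move=> k; exact: (mRV (T 0%N) [set n | inord n = k]).
  by rewrite probability_setT => /eqP; rewrite oner_eq0.
have tG : (t < G)%N.
  rewrite ltnNge; apply: contra_neqN Pt => Gt.
  rewrite (_ : _ @^-1` _ = set0) ?measure0//; apply/seteqP; split => w //= wt.
  by have := rangeT 0 w; rewrite wt; lia.
have Pt0 : 0 < fine (P (T 0%N @^-1` [set (t : nat)])) by rewrite lt0r Pt fine_ge0.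
rewrite /PB_sigma2 mulr_gt0 ?invr_gt0 ?mulr_gt0 ?subr_gt0//.
have tN : (1 <= t.+1 < N)%N by lia.
rewrite (bigD1_seq t.+1) ?iota_uniq ?mem_index_iota//=.
apply: ltr_wpDr.
  by apply: sumr_ge0 => x _; rewrite fine_ge0// expectation_ge0.
rewrite (expectation_at_risk tN).
rewrite (@sum_code_ge (fun u => (u < t.+1 <= u + s)%N))//.
rewrite mulr_gt0 ?exprn_gt0 ?subr_gt0//.
apply: (lt_le_trans Pt0); apply: fine_le; rewrite ?fin_num_measure//.
apply: le_measure; rewrite ?inE//.
by move=> w /= ->; rewrite ltnSn /= -addn1 leq_add2l.
Qed.

Lemma mart_sum_code z : (z.2 < G)%N ->
  mart_sum (N := N) theta s ((trunc_code z).1 : nat, (trunc_code z).2 : nat) =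
  mart_sum (N := N) theta s z.
Proof.
move=> zG; rewrite /mart_sum; apply: eq_big_nat => x /andP[x1 xN].
rewrite /mart_inc /= !trunc_codeE (minn_idPl (_ : z.2 <= N)%N); last by lia.
have -> : (minn z.1 N == x) = (z.1 == x) by apply/eqP/eqP; lia.
by have -> : (x <= minn z.1 N)%N = (x <= z.1)%N by apply/idP/idP; lia.
Qed.

Lemma PB_sumE n w : PB_sum G s theta X T n w =
  (Num.sqrt n%:R)^-1 * (theta * (1 - theta))^-1 *
  \sum_(i < n) mart_sum (N := N) theta s (X i w, T i w).
Proof.
rewrite /PB_sum -mulr_sumr; congr (_ * _).
rewrite /mart_sum exchange_big; apply: eq_big_nat => x /andP[x1 xN].
rewrite /increment /total_M -[in LHS](prednK x1) big_nat_recr//= prednK//.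
rewrite /total_count /total_at_risk.
transitivity (\sum_(i < n) (count_process s (X i) (T i) x w
  - count_process s (X i) (T i) x.-1 w - theta * at_risk s (X i) (T i) x.-1 w)).
  rewrite !sumrB -mulr_sumr; ring.
apply: eq_bigr => i _.
rewrite /count_process /at_risk /mart_inc /=.
move: (X i w) (T i w) => a t; rewrite prednK//.
(* Outside the window t < x <= t + s, the unit neither jumps at x nor is at risk; inside, the count
   jumps exactly when [a = x]. *)
have [tx|tx] := boolP (t < x <= t + s)%N; last first.
  rewrite mul0r (_ : [&& _, _ & _] = false); last by apply/negP; lia.
  rewrite mulr0 subr0; apply/eqP; rewrite subr_eq0; apply/eqP; congr (_%:R).
  by congr nat_of_bool; apply/idP/idP; lia.
rewrite mul1r (_ : [&& _, _ & _] = (x <= a)%N); last by apply/idP/idP; lia.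
rewrite (_ : (t < a <= minn x _)%N%:R =
  (t < a <= minn x.-1 (t + s))%N%:R + (a == x)%:R); first by ring.
have [ax|ax] := eqVneq a x.
  have -> : (t < a <= minn x (t + s))%N by lia.
  have -> : (t < a <= minn x.-1 (t + s))%N = false by apply/negP; lia.
  by rewrite add0r.
rewrite addr0; congr (_%:R); congr nat_of_bool; apply/idP/idP; lia.
Qed.

End truncation.

(** * Asymptotic normality of the statistic *)

Theorem theorem2 (R : realType) (G s : nat) (hG : (1 <= G)%N) (hs : (2 <= s)%N)
    (eps theta0 : R) (heps : 0 < eps < 2^-1)
    (htheta0 : eps <= theta0 <= 1 - eps)
    (d : measure_display) (Om : measurableType d) (P : probability Om R)
    (X T : nat -> {RV P >-> nat})
    (iidXT : iid_RVs (fun i : nat =>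
       pair_RV (X i) (T i) : {RV P >-> (nat * nat)%type}))
    (geomX : forall i : nat, geometric_RV theta0 (X i))
    (rangeT : forall (i : nat) (w : Om), (T i w < G)%N)
    (indepXT : forall i : nat, independent_RVs (X i) (T i))
    (d' : measure_display) (Om' : measurableType d') (P' : probability Om' R)
    (Z : {RV P' >-> R})
    (normZ : forall A : set R, measurable A ->
       distribution P' Z A = normal_prob 0 1 A) :
  cvg_in_distribution
    (fun n : nat => PB_sum G s theta0 X T n : {RV P >-> R})
    (PB_sigma G s theta0 X T \o* Z : {RV P' >-> R}).
Proof.
have theta01 : 0 < theta0 < 1 by lra.
have s1 : (1 <= s)%N by exact: ltnW.
pose c : R := (theta0 * (1 - theta0))^-1; pose sg := PB_sigma G s theta0 X T.
pose ms := mart_sum (N := s + G) theta0 s.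
pose p := @code_prob _ _ _ P G s X T.
have s20 := PB_sigma2_gt0 (geomX 0%N) rangeT (indepXT 0%N) theta01 s1.
have sg0 : 0 < sg by rewrite /sg /PB_sigma sqrtr_gt0.
have tt0 : 0 < theta0 * (1 - theta0) by rewrite mulr_gt0//; lra.
(* Standardised summands: [ms] has variance [(sg / c) ^+ 2], so the factor [c / sg] brings it to
   1. *)
pose v (k : 'I_(s + G).+1 * 'I_(s + G).+1) : R := c / sg * ms (k.1 : nat, k.2 : nat).
have hp b x := sum_code_eq_ge (s := s) (geomX 0%N) rangeT (indepXT 0%N) b (x := x) theta01.
have p0 : forall k, 0 <= p k := @code_prob_ge0 _ _ _ P G s X T.
have p1 : \sum_k p k = 1 := sum_code_prob1 G s X T.
have pv0 : \sum_k p k * v k = 0.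
  under eq_bigr do rewrite mulrCA.
  by rewrite -mulr_sumr (sum_mart_sum s hp) mulr0.
have pv2 : \sum_k p k * v k ^+ 2 = 1.
  under eq_bigr do rewrite exprMn mulrCA.
  rewrite -mulr_sumr (sum_mart_sum_sqr s hp).
  have -> : \sum_(1 <= x < s + G) \sum_k p k * ((k.2 < x <= k.2 + s) && (x <= k.1))%N%:R =
      theta0 * (1 - theta0) * sg ^+ 2.
    rewrite /sg /PB_sigma sqr_sqrtr ?ltW// /PB_sigma2 mulVKf ?gt_eqF//.
    by apply: eq_big_nat => x xN; rewrite (expectation_at_risk X rangeT xN).
  rewrite /c; field; apply/and3P; split; apply: lt0r_neq0; lra.
have PBE n w : PB_sum G s theta0 X T n w =
    sg * \sum_(i < n) (v (trunc_code G s (X i w, T i w)) / Num.sqrt n%:R).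
  rewrite PB_sumE !mulr_sumr; apply: eq_bigr => i _.
  rewrite /v /ms mart_sum_code; last exact: rangeT.
  move: (mart_sum _ _ _) (Num.sqrt n%:R)^-1 => m q; rewrite -/c; field.
  exact: lt0r_neq0.
have indepV := iidXT.1.
have pE i k : fine (P (pair_RV (X i) (T i) @^-1` (trunc_code G s @^-1` [set k]))) = p k.
  by rewrite /p /code_prob; congr fine; apply: (iidXT.2 i 0%N); exact: measurable_natnat.
(* The statistic is [sg] times the normalised walk; as [sg] is positive, its distribution function
   at [r] is that of the walk at [r / sg]. *)
have cdfS n r : cdf (PB_sum G s theta0 X T n : {RV P >-> R}) r =
    (walk p (fun k => v k / Num.sqrt n%:R) n (fun x => (x <= r / sg)%R%:R) 0)%:E.
  pose S := [set w | \sum_(i < n) (v (trunc_code G s (X i w, T i w)) / Num.sqrt n%:R) <= r / sg].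
  have cdfE : cdf (PB_sum G s theta0 X T n : {RV P >-> R}) r = P S.
    rewrite /cdf /distribution /pushforward; congr (P _); apply/seteqP.
    by split => w; rewrite /S /= in_itv /= PBE ler_pdivlMr// mulrC.
  rewrite -(probability_walk (fun k => measurable_natnat _) pE indepV
    (fun k => v k / Num.sqrt n%:R) (fun x => x <= r / sg)).
  by rewrite -[LHS]fineK ?fin_num_measure// cdfE.
have cdfL r : cdf (PB_sigma G s theta0 X T \o* Z : {RV P' >-> R}) r = (gauss_cdf (r / sg))%:E.
  rewrite gauss_cdfE -normZ// /cdf /distribution /pushforward; congr (P' _).
  apply/seteqP; split => w /=; rewrite !in_itv /= -/sg ler_pdivlMr//.
move=> r _; rewrite cdfL; under eq_fun do rewrite cdfS.
apply: cvg_EFin; first by near=> n.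
exact: (walk_cdf_cvg p0 p1 pv0 pv2).
Unshelve. all: by end_near. Qed.
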